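(* Let $n\ge 2$ be an integer, and let $p\in[0,1)$ and $q\in(0,1]$ with $(p,q)\ne(0,1)$. In a game of Knockout with $n$ players, each having probability $p$ of making a long shot and probability $q$ of making a short shot, the expected number of steps before someone wins equals $$\frac{-(n-1)\left(p+q-3\right)\left(p^{2}-pq-2p+2q+1\right)}{q\left(p-3\right)\left(p-1\right)\left(p-q+1\right)}.$$
   Context: A game of Knockout with $n$ players consists of $n-1$ successive rounds with $n, n-1,\dots,2$ players respectively. Each round ends when one player is eliminated. The survivors then start a new round from its initial state, relabelled according to the new line order and with shots independent of previous rounds. The last remaining player wins. The number of steps of the game is the total number of steps over all rounds. A round with $m\ge2$ equally skilled players $P_1,\dots,P_m$ (indices modulo $m$, $P_{k+1}$ directly behind $P_k$) is modelled as an absorbing Markov chain. Long shots (LS) are made with probability $p$ and short shots (SS) with probability $q$, independently. The transient states are pairs $(b,k)$ with $b\in\{1,2,3,4,5\}$ and $k\in\mathbb{Z}/m$, meaning: $(1,k)$: $P_k$ takes LS, then $P_{k+1}$ takes LS. $(2,k)$: $P_k$ takes SS, then $P_{k+1}$ takes SS. $(3,k)$: $P_{k+1}$ takes SS, then $P_k$ takes SS. $(4,k)$: $P_k$ takes SS, then $P_{k+1}$ takes LS. $(5,k)$: $P_{k+1}$ takes LS, then $P_k$ takes SS. In each of these states $P_k$ is the player in danger of being eliminated by $P_{k+1}$. The absorbing states are $E_k$, $k\in\mathbb{Z}/m$: ''$P_k$ is eliminated''. Each round starts in $(1,1)$. The transition probabilities (all others being $0$) are: From $(1,k)$: to $(1,k+2)$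 with $p^2$, to $(2,k)$ with $(1-p)^2$, to $(5,k+1)$ with $p(1-p)$, to $E_k$ with $(1-p)p$. From $(2,k)$: to $(1,k+2)$ with $q^2$, to $(2,k)$ with $(1-q)^2$, to $(5,k+1)$ with $q(1-q)$, to $E_k$ with $(1-q)q$. From $(3,k)$: to $(3,k)$ with $(1-q)^2$, to $(4,k+1)$ with $(1-q)q$, to $E_k$ with $q$. From $(4,k)$: to $(1,k+2)$ with $qp$, to $(2,k)$ with $(1-q)(1-p)$, to $(5,k+1)$ with $q(1-p)$, to $E_k$ with $(1-q)p$. From $(5,k)$: to $(3,k)$ with $(1-p)(1-q)$, to $(4,k+1)$ with $(1-p)q$, to $E_k$ with $p$. Each $E_k$ stays put with probability $1$. For $m=2$ the states reachable from $(1,1)$ are only $(1,1),(2,1),(4,1),(5,2),(3,2)$ and $E_1,E_2$. A step of a round is one transition of its chain before absorption, the transition into the absorbing state being counted. *)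

(* Defs.v *)
From HB Require Import structures.
From mathcomp Require Import all_boot all_order all_algebra.
From mathcomp Require Import all_classical all_reals all_analysis.
Set Implicit Arguments.
Unset Strict Implicit.
Unset Printing Implicit Defensive.
Import Order.TTheory GRing.Theory Num.Theory.
Import numFieldNormedType.Exports.
Local Open Scope classical_set_scope.
Local Open Scope ring_scope.

(* S1 k, ..., S5 k are the transient states (1, k), ..., (5, k) and E k is the
   absorbing state "P_k is eliminated". Since 'Z_0 = 'Z_1 = 'Z_2, this type is
   only meant for m >= 2. *)
Variant state (m : nat) : Type :=
  | S1 of 'Z_m   (* P_k takes LS, then P_(k+1) takes LS *)
  | S2 of 'Z_m   (* P_k takes SS, then P_(k+1) takes SS *)
  | S3 of 'Z_m   (* P_(k+1) takes SS, then P_k takes SS *)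
  | S4 of 'Z_m   (* P_k takes SS, then P_(k+1) takes LS *)
  | S5 of 'Z_m   (* P_(k+1) takes LS, then P_k takes SS *)
  | E of 'Z_m.

Definition absorbed (m : nat) (s : state m) : bool :=
  if s is E _ then true else false.

Definition transition (R : realType) (p q : R) (m : nat) (s t : state m) : R :=
  match s, t with
  | S1 k, S1 l => if l == k + 2%:R then p ^+ 2 else 0
  | S1 k, S2 l => if l == k then (1 - p) ^+ 2 else 0
  | S1 k, S5 l => if l == k + 1 then p * (1 - p) else 0
  | S1 k, E l => if l == k then (1 - p) * p else 0
  | S2 k, S1 l => if l == k + 2%:R then q ^+ 2 else 0
  | S2 k, S2 l => if l == k then (1 - q) ^+ 2 else 0
  | S2 k, S5 l => if l == k + 1 then q * (1 - q) else 0
  | S2 k, E l => if l == k then (1 - q) * q else 0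
  | S3 k, S3 l => if l == k then (1 - q) ^+ 2 else 0
  | S3 k, S4 l => if l == k + 1 then (1 - q) * q else 0
  | S3 k, E l => if l == k then q else 0
  | S4 k, S1 l => if l == k + 2%:R then q * p else 0
  | S4 k, S2 l => if l == k then (1 - q) * (1 - p) else 0
  | S4 k, S5 l => if l == k + 1 then q * (1 - p) else 0
  | S4 k, E l => if l == k then (1 - q) * p else 0
  | S5 k, S3 l => if l == k then (1 - p) * (1 - q) else 0
  | S5 k, S4 l => if l == k + 1 then (1 - p) * q else 0
  | S5 k, E l => if l == k then p else 0
  | E k, E l => if l == k then 1 else 0
  | _, _ => 0
  end.

(* Time-homogeneous Markov chain with finite state space S (all of whose
   subsets are measurable), transition matrix K and initial state x0. The Markov
   property P(X_(t+1) = x_(t+1) | X_0 = x_0, ..., X_t = x_t) = K x_t x_(t+1) is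
   multiplied out so that it also makes sense for null conditioning events. *)
Definition markov_chain (R : realType) (d : measure_display)
    (Omega : measurableType d) (P : probability Omega R)
    (S : Type) (K : S -> S -> R) (x0 : S) (X : nat -> Omega -> S) : Prop :=
  [/\ forall (t : nat) (B : set S), measurable (X t @^-1` B),
      P [set w | X 0%N w = x0] = 1%E &
      forall (t : nat) (x : nat -> S),
        P [set w | forall i, (i <= t.+1)%N -> X i w = x i] =
        (P [set w | forall i, (i <= t)%N -> X i w = x i] *
         (K (x t) (x t.+1))%:E)%E].

Definition sigma_of (Omega S : Type) (X : nat -> Omega -> S) : set (set Omega) :=
  <<s [set A | exists t B, A = X t @^-1` B] >>.

(* Mutual independence of the families of events F i, for i in D. *)
Definition mutually_independent (R : realType) (d : measure_display)
    (Omega : measurableType d) (P : probability Omega R)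
    (I : eqType) (D : set I) (F : I -> set (set Omega)) : Prop :=
  forall (J : seq I) (A : I -> set Omega), uniq J ->
    (forall i, i \in J -> D i /\ F i (A i)) ->
    P (\big[setI/setT]_(i <- J) A i) = (\prod_(i <- J) P (A i))%E.

(* X m is the chain of the round with m players; only 2 <= m <= n matters.
   A round always starts in (1, 1) and does not depend on the previous rounds,
   whatever the new line order is. *)
Definition knockout_game (R : realType) (d : measure_display)
    (Omega : measurableType d) (P : probability Omega R)
    (p q : R) (n : nat) (X : forall m : nat, nat -> Omega -> state m) : Prop :=
  (forall m : nat, (2 <= m <= n)%N ->
     markov_chain P (@transition R p q m) (S1 (1 : 'Z_m)) (X m)) /\
  mutually_independent P [set m : nat | (2 <= m <= n)%N]
    (fun m => sigma_of (X m)).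

(* Number of transitions up to and including the one into an absorbing state;
   it is +oo if there is none. *)
Definition round_steps (R : realType) (Omega : Type) (m : nat)
    (X : nat -> Omega -> state m) (w : Omega) : \bar R :=
  ereal_inf [set (t%:R)%:E | t in [set t : nat | absorbed (X t w)]].

Definition game_steps (R : realType) (Omega : Type) (n : nat)
    (X : forall m : nat, nat -> Omega -> state m) (w : Omega) : \bar R :=
  (\sum_(2 <= m < n.+1) round_steps R (X m) w)%E.

(* Main.v *)
Require Import Defs.
From HB Require Import structures.
From mathcomp Require Import all_boot all_order all_algebra.
From mathcomp Require Import ring lra.
From mathcomp Require Import all_classical all_reals all_analysis.
From mathcomp Require Import measurable_realfun.
Import Order.TTheory GRing.Theory Num.Theory.
Import numFieldNormedType.Exports.
Local Open Scope classical_set_scope.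
Local Open Scope ring_scope.

(** By linearity of expectation the game lasts, on average, the sum of the
expected lengths of its [n - 1] rounds, so it is enough to show that a round
has the same expected length whatever its number [m] of players. This holds
because the transition matrix depends on the position [k] only through shifts:
the five types of transient states form a Markov chain by themselves, and
first-step analysis gives five linear equations, free of [m], for the expected
remaining times [h1, ..., h5].

First-step analysis itself is justified by a potential argument on an
arbitrary finite chain ([expected_hitting_time]). Let [h >= 0] vanish on the
target set [A] and satisfy [h x = 1 + \sum_y K x y * h y] elsewhere, and let
[s_t] be the probability that [X_0, ..., X_t] all avoid [A]. The Markov
property gives the telescoping identity
[\sum_(t < N) s_t = h x0 - u_N], where [u_N] is the expectation of [h X_N] on
the event that [A] was avoided up to time [N] ([hitting_time_potential]). Since
[u_N >= 0], the series of the [s_t] converges, so [s_N] tends to 0; as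
[u_N <= (\sum_x h x) * s_N], the remainder [u_N] tends to 0 as well, and
[\sum_t s_t = h x0]. Finally the hitting time of [A] is the sum over [t] of
the indicators of the events of probability [s_t], so [\sum_t s_t] is its
expectation.

For a round, such a solution is written down explicitly ([round_potential]).
Its denominators involve [q], [3 - p], [1 - p] and [1 + p - q], the last of
which vanishes, in the given range of [p] and [q], only at the excluded point
[(0, 1)], where a round alternates forever between types 1 and 2. *)

(** * Finite-valued random elements and the Markov property *)

(** Measurability is only known for preimages under each [X t]; through the
fibers it extends to any random element with finitely many values, such as a
finite portion of the trajectory. *)
Lemma measurable_preimage_fin {d : measure_display} {Omega : measurableType d}
    {F : finType} {Z : Omega -> F} (B : set F) :
  (forall z, measurable (Z @^-1` [set z])) -> measurable (Z @^-1` B).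
Proof.
move=> mZ; have -> : Z @^-1` B = \bigcup_(z in B) Z @^-1` [set z].
  by apply/seteqP; split => w /=; [exists (Z w)|case=> z Bz /= ->].
by apply: fin_bigcup_measurable => //; exact: finite_finset.
Qed.

Lemma fine_measure_partition {d : measure_display} {Omega : measurableType d}
    {R : realType} (P : probability Omega R) {F : finType} {Z : Omega -> F}
    {A : set Omega} :
  measurable A -> (forall z, measurable (Z @^-1` [set z])) ->
  fine (P A) = \sum_z fine (P (A `&` Z @^-1` [set z])).
Proof.
move=> mA mZ; have mAZ z : measurable (A `&` Z @^-1` [set z]).
  exact: measurableI.
rewrite sum_fine => [|z _]; last exact: fin_num_measure.
congr fine.
have AE : A = \bigcup_(z in [set` index_enum F]) (A `&` Z @^-1` [set z]).
  apply/seteqP; split => w /=; last by case=> z _ [].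
  by move=> Aw; exists (Z w) => //=; rewrite mem_index_enum.
rewrite [in LHS]AE measure_fin_bigcup.
- by rewrite -fsbig_seq ?index_enum_uniq.
- exact: finite_finset.
- by move=> i j _ _ [w [[_ /= <-] [_ /= <-]]].
- by move=> z _; exact: mAZ.
Qed.

Definition history {Omega S : Type} (X : nat -> Omega -> S) (t : nat)
    (w : Omega) : {ffun 'I_t.+1 -> S} := [ffun i : 'I_t.+1 => X i w].

Lemma measurable_history {d : measure_display} {Omega : measurableType d}
    {S : finType} {X : nat -> Omega -> S} (t : nat)
    (B : set {ffun 'I_t.+1 -> S}) :
  (forall t (B : set S), measurable (X t @^-1` B)) ->
  measurable (history X t @^-1` B).
Proof.
move=> mX; apply: measurable_preimage_fin => f.
have -> : history X t @^-1` [set f] =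
    \bigcap_(i in [set: 'I_t.+1]) X i @^-1` [set f i].
  apply/seteqP; split => w /=; first by move=> <- i _ /=; rewrite ffunE.
  by move=> Xf; apply/ffunP => i; rewrite ffunE; exact: Xf.
by apply: fin_bigcap_measurable => //; exact: finite_finset.
Qed.

(** The Markov property for an arbitrary past event [B], obtained from the one
for single trajectories by summing over all trajectories up to time [t]. Those
in [B] that end at [x] contribute the factor [K x y]; for the others both
events are empty. *)
Lemma markov_history {R : realType} {d : measure_display}
    {Omega : measurableType d} {P : probability Omega R} {S : finType}
    {K : S -> S -> R} {x0 : S} {X : nat -> Omega -> S} (t : nat)
    (B : set {ffun 'I_t.+1 -> S}) (x y : S) :
  markov_chain P K x0 X ->
  fine (P ((history X t @^-1` B `&` X t.+1 @^-1` [set y]) `&` X t @^-1` [set x])) =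
  fine (P (history X t @^-1` B `&` X t @^-1` [set x])) * K x y.
Proof.
case=> mX _ XK.
have mB : measurable (history X t @^-1` B) by exact: measurable_history.
rewrite (fine_measure_partition P (Z := history X t)); first last.
- by move=> f; exact: measurable_history.
- by do 2 apply: measurableI => //.
rewrite [in RHS](fine_measure_partition P (Z := history X t)); first last.
- by move=> f; exact: measurable_history.
- exact: measurableI.
rewrite mulr_suml; apply: eq_bigr => f _.
have [[Bf fx]|nBf] := pselect (B f /\ f ord_max = x); last first.
  rewrite [X in P X](_ : _ = set0) ?[X in _ = fine (P X) * _](_ : _ = set0)
    ?measure0 ?mul0r//.
  - apply/seteqP; split=> w //= [[Bw xw] fw]; apply: nBf; rewrite -fw; split=> //.
    by rewrite ffunE.
  - apply/seteqP; split=> w //= [[[Bw yw] xw] fw].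
    apply: nBf; rewrite -fw; split=> //.
    by rewrite ffunE.
(* The path whose last step has probability [K x y]: [f] up to [t], then [y]. *)
pose z i := if (i <= t)%N then f (inord i) else y.
have past w : history X t w = f <-> forall i, (i <= t)%N -> X i w = z i.
  split=> [hf i it|Xz]; first by rewrite /z it -hf ffunE inordK.
  apply/ffunP => i; have it : (i <= t)%N by rewrite -ltnS.
  by rewrite ffunE Xz// /z it inord_val.
have zt : z t = x.
  by rewrite /z leqnn -fx; congr (f _); apply/val_inj; rewrite /= inordK.
have zt1 : z t.+1 = y by rewrite /z ltnn.
have /(congr1 fine) := XK t z; rewrite fineM//; last first.
  apply: fin_num_measure.
  rewrite [X in measurable X](_ : _ = history X t @^-1` [set f]).
    exact: measurable_history.
  by apply/seteqP; split => w /= /past.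
rewrite /= zt zt1 => XKz.
rewrite [X in P X](_ : _ = [set w | forall i, (i <= t.+1)%N -> X i w = z i]).
  rewrite XKz; congr (fine (P _) * _); apply/seteqP; split => w /=.
    move=> /past hf; split=> //; split; first by rewrite hf.
    by move: hf => /past ->.
  by move=> [_ /past].
apply/seteqP; split => w /=.
  move=> [[[_ Xy] _] /past Xz] i; rewrite leq_eqVlt => /predU1P[->|].
    by rewrite zt1.
  by rewrite ltnS; exact: Xz.
move=> Xz; have hf : history X t w = f by apply/past => i it; apply: Xz; exact: leqW.
split=> //; split; last by rewrite Xz.
by rewrite hf Xz.
Qed.

(** * Expected hitting times of finite Markov chains *)

Definition avoiding {Omega S : Type} (A : pred S) (X : nat -> Omega -> S)
    (t : nat) : set Omega :=
  [set w | forall i, (i <= t)%N -> ~~ A (X i w)].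

Lemma avoiding_history {Omega S : Type} (A : pred S) (X : nat -> Omega -> S)
    (t : nat) :
  avoiding A X t = history X t @^-1` [set f | forall i, ~~ A (f i)].
Proof.
apply/seteqP; split => w /= XA i; first by rewrite ffunE; apply: XA; rewrite -ltnS.
by rewrite -ltnS => it; have := XA (Ordinal it); rewrite ffunE.
Qed.

Lemma measurable_avoiding {d : measure_display} {Omega : measurableType d}
    {S : finType} {X : nat -> Omega -> S} (A : pred S) (t : nat) :
  (forall t (B : set S), measurable (X t @^-1` B)) ->
  measurable (avoiding A X t).
Proof. by move=> mX; rewrite avoiding_history; exact: measurable_history. Qed.

(** The hitting time is larger than [t] exactly when [A] is avoided up to time
[t]. When [A] is never hit, both sides are infinite. *)
Lemma hitting_time_series {R : realType} {Omega S : Type} (A : pred S)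
    (X : nat -> Omega -> S) (w : Omega) :
  ereal_inf [set (t%:R : R)%:E | t in [set t | A (X t w)]] =
  (\sum_(t <oo) (\1_(avoiding A X t) w)%:E)%E.
Proof.
have [[N AN]|nA] := pselect (exists t, A (X t w)); last first.
  rewrite (_ : [set t | _] = set0) ?image_set0 ?ereal_inf0; last first.
    by apply/seteqP; split => // t At; apply: nA; exists t.
  apply/esym/cvg_lim => //.
  rewrite (_ : (fun _ => _) = (fun n => (n%:R : R)%:E)).
    by apply/cvgenyP.
  apply/funext => n; rewrite (eq_bigr (fun=> 1%:E)).
    by rewrite sumEFin big_mkord sumr_const card_ord.
  move=> i _; rewrite indicE mem_set//= => j _.
  by apply/negP => Aj; apply: nA; exists j.
have exA : exists t, A (X t w) by exists N.
case: (ex_minnP exA) => {AN exA}N AN minN.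
have aE t : (\1_(avoiding A X t) w : R) = (t < N)%:R.
  rewrite indicE; congr (nat_of_bool _)%:R; apply/idP/idP; rewrite inE/=.
    by move=> av; rewrite ltnNge; apply/negP => /av; rewrite AN.
  move=> tN i it; apply/negP => /minN; rewrite leqNgt => /negP; apply.
  exact: leq_ltn_trans tN.
rewrite (nneseries_split 0 N); last by move=> k _; rewrite lee_fin aE.
rewrite add0n eseries0 => [|i Ni _]; last by rewrite aE ltnNge Ni.
rewrite adde0 sumEFin big_mkord (eq_bigr (fun=> 1)) => [|i _]; last first.
  by rewrite aE ltn_ord.
rewrite sumr_const card_ord; apply/eqP; rewrite eq_le; apply/andP; split.
  by apply: ereal_inf_lbound; exists N.
by apply: le_ereal_inf_tmp => _ [t /= At <-]; rewrite lee_fin ler_nat minN.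
Qed.

Definition survival {R : realType} {d : measure_display}
    {Omega : measurableType d} (P : probability Omega R) {S : Type}
    (A : pred S) (X : nat -> Omega -> S) (t : nat) : R :=
  fine (P (avoiding A X t)).

(** The law at time [t] of the chain killed on entering [A]. *)
Definition occupation {R : realType} {d : measure_display}
    {Omega : measurableType d} (P : probability Omega R) {S : Type}
    (A : pred S) (X : nat -> Omega -> S) (t : nat) (x : S) : R :=
  fine (P (avoiding A X t `&` X t @^-1` [set x])).

Lemma survival_sum {R : realType} {d : measure_display}
    {Omega : measurableType d} (P : probability Omega R) {S : finType}
    (A : pred S) (X : nat -> Omega -> S) (t : nat) :
  (forall t (B : set S), measurable (X t @^-1` B)) ->
  survival P A X t = \sum_x occupation P A X t x.
Proof.
move=> mX; apply: fine_measure_partition => [|x]; last exact: mX.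
exact: measurable_avoiding.
Qed.

Lemma occupation_target {R : realType} {d : measure_display}
    {Omega : measurableType d} (P : probability Omega R) {S : Type}
    (A : pred S) (X : nat -> Omega -> S) (t : nat) (x : S) :
  A x -> occupation P A X t x = 0.
Proof.
move=> Ax; rewrite /occupation [X in P X](_ : _ = set0) ?measure0//.
by apply/seteqP; split => w //= [/(_ t (leqnn t)) + Xx]; rewrite Xx Ax.
Qed.

(** The chain killed on [A] evolves by the restriction of [K] to the complement
of [A]. *)
Lemma occupationS {R : realType} {d : measure_display}
    {Omega : measurableType d} {P : probability Omega R} {S : finType}
    {K : S -> S -> R} {x0 : S} {X : nat -> Omega -> S} (A : pred S)
    (t : nat) (y : S) :
  markov_chain P K x0 X -> ~~ A y ->
  occupation P A X t.+1 y = \sum_x occupation P A X t x * K x y.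
Proof.
move=> mcX nAy; have [mX _ _] := mcX.
rewrite /occupation.
have -> : avoiding A X t.+1 `&` X t.+1 @^-1` [set y] =
          avoiding A X t `&` X t.+1 @^-1` [set y].
  apply/seteqP; split => w /= [XA Xy]; split=> // i it.
    by apply: XA; exact: leqW.
  by move: it; rewrite leq_eqVlt => /predU1P[->|/XA//]; rewrite Xy.
rewrite (fine_measure_partition P (Z := X t)).
- by apply: eq_bigr => x _; rewrite avoiding_history (markov_history _ _ _ _ mcX).
- by apply: measurableI => //; exact: measurable_avoiding.
- by move=> x; exact: mX.
Qed.

Lemma occupation0 {R : realType} {d : measure_display}
    {Omega : measurableType d} {P : probability Omega R} {S : finType}
    {K : S -> S -> R} {x0 : S} {X : nat -> Omega -> S} (A : pred S) (x : S) :
  markov_chain P K x0 X -> ~~ A x ->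
  occupation P A X 0 x = (x == x0)%:R.
Proof.
move=> [mX X0 _] nAx; rewrite /occupation.
have -> : avoiding A X 0 `&` X 0%N @^-1` [set x] = X 0%N @^-1` [set x].
  apply/seteqP; split => w /=; first by case.
  by move=> Xx; split=> // i; rewrite leqn0 => /eqP ->; rewrite Xx.
have [->|xx0] := eqVneq x x0; first by rewrite X0.
suff -> : P (X 0%N @^-1` [set x]) = 0%E by [].
apply/eqP; rewrite eq_le measure_ge0 andbT.
have <- : P (~` (X 0%N @^-1` [set x0])) = 0%E.
  by rewrite probability_setC ?X0 ?subee//; exact: mX.
apply: le_measure; rewrite ?inE; [exact: mX|by apply: measurableC; exact: mX|].
by move=> w /= -> /eqP; rewrite (negbTE xx0).
Qed.

(** The quantity [u_N = \sum_x occupation P A X N x * h x] drops by exactly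
[survival P A X N] at each step: one application of [K] to [h] costs 1 wherever
the killed chain can be, and the mass sent into [A] does not count because [h]
vanishes there. The identity is the telescoped form. *)
Lemma hitting_time_potential {R : realType} {d : measure_display}
    {Omega : measurableType d} {P : probability Omega R} {S : finType}
    {K : S -> S -> R} {x0 : S} {X : nat -> Omega -> S} {A : pred S}
    {h : S -> R} :
  markov_chain P K x0 X ->
  (forall x, A x -> h x = 0) ->
  (forall x, ~~ A x -> h x = 1 + \sum_y K x y * h y) ->
  forall N, series (survival P A X) N = h x0 - \sum_x occupation P A X N x * h x.
Proof.
move=> mcX hA hnA; have [mX _ _] := mcX.
elim=> [|N IHN].
  rewrite /series /= big_geq// (bigD1 x0)//= big1 ?addr0.
    have [/hA->|nAx0] := boolP (A x0); first by rewrite mulr0 subr0.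
    by rewrite (occupation0 _ _ mcX)// eqxx mul1r subrr.
  move=> x xx0; have [/hA->|nAx] := boolP (A x); first by rewrite mulr0.
  by rewrite (occupation0 _ _ mcX)// (negbTE xx0) mul0r.
rewrite seriesSr IHN.
suff -> : \sum_x occupation P A X N x * h x =
    survival P A X N + \sum_x occupation P A X N.+1 x * h x by ring.
(* On [A] the equation for [h] need not hold, but there the weight is 0. *)
transitivity (\sum_x occupation P A X N x * (1 + \sum_y K x y * h y)).
  apply: eq_bigr => x _; have [Ax|/hnA->//] := boolP (A x).
  by rewrite occupation_target// !mul0r.
under eq_bigr do rewrite mulrDr mulr1 mulr_sumr.
rewrite big_split/= -survival_sum//; congr (_ + _).
rewrite exchange_big/=; apply: eq_bigr => y _.
have [/hA ->|nAy] := boolP (A y).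
  by rewrite mulr0 big1// => x _; rewrite !mulr0.
by rewrite (occupationS _ _ _ mcX)// mulr_suml; apply: eq_bigr => x _; rewrite mulrA.
Qed.

Lemma occupation_ge0 {R : realType} {d : measure_display}
    {Omega : measurableType d} (P : probability Omega R) {S : Type}
    (A : pred S) (X : nat -> Omega -> S) (t : nat) (x : S) :
  0 <= occupation P A X t x.
Proof. by rewrite fine_ge0// measure_ge0. Qed.

Lemma survival_ge0 {R : realType} {d : measure_display}
    {Omega : measurableType d} (P : probability Omega R) {S : Type}
    (A : pred S) (X : nat -> Omega -> S) (t : nat) :
  0 <= survival P A X t.
Proof. by rewrite fine_ge0// measure_ge0. Qed.

(** The partial sums [h x0 - u N] are nondecreasing and at most [h x0], so their
terms tend to 0; since [h] is bounded, this forces [u N] to 0, which identifies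
the limit. *)
Lemma cvg_series_survival {R : realType} {d : measure_display}
    {Omega : measurableType d} {P : probability Omega R} {S : finType}
    {K : S -> S -> R} {x0 : S} {X : nat -> Omega -> S} {A : pred S}
    {h : S -> R} :
  markov_chain P K x0 X ->
  (forall x, 0 <= h x) ->
  (forall x, A x -> h x = 0) ->
  (forall x, ~~ A x -> h x = 1 + \sum_y K x y * h y) ->
  series (survival P A X) @ \oo --> h x0.
Proof.
move=> mcX h0 hA hnA; have [mX _ _] := mcX.
pose u N := \sum_x occupation P A X N x * h x.
have seriesE N : series (survival P A X) N = h x0 - u N.
  exact: (hitting_time_potential mcX hA hnA).
have u0 N : 0 <= u N by apply: sumr_ge0 => x _; rewrite mulr_ge0 ?occupation_ge0.
have cvgs : cvgn (series (survival P A X)).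
  apply: nondecreasing_is_cvgn.
    by apply: nondecreasing_series => n _ _; exact: survival_ge0.
  by exists (h x0) => _ [N _ <-]; rewrite seriesE gerBl.
have u_to0 : u @ \oo --> (0 : R).
  apply: (@squeeze_cvgr _ _ _ _ (cst 0) (fun N => (\sum_x h x) * survival P A X N)).
  - apply: nearW => N; rewrite u0/= survival_sum// mulr_sumr; apply: ler_sum => x _.
    rewrite mulrC ler_wpM2r ?occupation_ge0// (bigD1 x)//= lerDl.
    by apply: sumr_ge0.
  - exact: cvg_cst.
  - have s0 : survival P A X @ \oo --> (0 : R) by exact: cvg_series_cvg_0.
    have := @cvgM _ _ _ _ (cst (\sum_x h x)) _ _ _ (cvg_cst _) s0.
    by rewrite mulr0; exact.
rewrite (_ : series _ = cst (h x0) - u); last by apply/funext => N; rewrite seriesE.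
by rewrite -[X in _ --> X]subr0; apply: cvgB => //; exact: cvg_cst.
Qed.

Lemma measurable_hitting_time {R : realType} {d : measure_display}
    {Omega : measurableType d} {S : finType} {X : nat -> Omega -> S}
    (A : pred S) :
  (forall t (B : set S), measurable (X t @^-1` B)) ->
  measurable_fun [set: Omega]
    ((fun w => ereal_inf [set (t%:R : R)%:E | t in [set t | A (X t w)]])
     : Omega -> \bar R).
Proof.
move=> mX; rewrite (_ : (fun w => _) = fun w =>
    (\sum_(0 <= t <oo | t \in predT) (\1_(avoiding A X t) w)%:E)%E).
  apply: ge0_emeasurable_sum => [t w _ _|t _]; first by rewrite lee_fin.
  by apply/measurable_EFinP; apply: measurable_indic; exact: measurable_avoiding.
by apply/funext => w; exact: hitting_time_series.
Qed.

(** First-step analysis: a nonnegative solution of the first-step equations is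
necessarily the expected hitting time, which is thereby finite. *)
Theorem expected_hitting_time {R : realType} {d : measure_display}
    {Omega : measurableType d} {P : probability Omega R} {S : finType}
    {K : S -> S -> R} {x0 : S} {X : nat -> Omega -> S} {A : pred S}
    (h : S -> R) :
  markov_chain P K x0 X ->
  (forall x, 0 <= h x) ->
  (forall x, A x -> h x = 0) ->
  (forall x, ~~ A x -> h x = 1 + \sum_y K x y * h y) ->
  (\int[P]_w ereal_inf [set (t%:R : R)%:E | t in [set t | A (X t w)]] =
   (h x0)%:E)%E.
Proof.
move=> mcX h0 hA hnA; have [mX _ _] := mcX.
transitivity (\int[P]_w (\sum_(t <oo) (\1_(avoiding A X t) w)%:E))%E.
  by apply: eq_integral => w _; exact: hitting_time_series.
rewrite integral_nneseries//; last first.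
  move=> t; apply/measurable_EFinP; apply: measurable_indic.
  exact: measurable_avoiding.
have indE t : (\int[P]_w (\1_(avoiding A X t) w)%:E = (survival P A X t)%:E)%E.
  rewrite integral_indic//; last exact: measurable_avoiding.
  rewrite setIT /survival fineK//; apply: fin_num_measure.
  exact: measurable_avoiding.
under eq_eseriesr do rewrite indE.
apply/cvg_lim => //.
rewrite (_ : (fun n => _) = EFin \o series (survival P A X)).
  by apply: cvg_EFin; [exact: nearW | exact: (cvg_series_survival mcX)].
by apply/funext => N /=; rewrite sumEFin.
Qed.

(** * A round of Knockout *)

(** The states form a finite type because they are six copies of ['Z_m]; the
disjoint sum also splits a sum over all states into six sums over positions. *)
Definition state_code {m : nat} (s : state m) :
    'Z_m + ('Z_m + ('Z_m + ('Z_m + ('Z_m + 'Z_m)))) :=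
  match s with
  | S1 k => inl k
  | S2 k => inr (inl k)
  | S3 k => inr (inr (inl k))
  | S4 k => inr (inr (inr (inl k)))
  | S5 k => inr (inr (inr (inr (inl k))))
  | E k => inr (inr (inr (inr (inr k))))
  end.

Definition state_decode {m : nat}
    (c : 'Z_m + ('Z_m + ('Z_m + ('Z_m + ('Z_m + 'Z_m))))) : state m :=
  match c with
  | inl k => S1 k
  | inr (inl k) => S2 k
  | inr (inr (inl k)) => S3 k
  | inr (inr (inr (inl k))) => S4 k
  | inr (inr (inr (inr (inl k)))) => S5 k
  | inr (inr (inr (inr (inr k)))) => E k
  end.

Lemma state_codeK {m : nat} : cancel (@state_code m) state_decode.
Proof. by case. Qed.

Lemma state_decodeK {m : nat} : cancel (@state_decode m) state_code.
Proof. by do 5![case=> //]. Qed.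

HB.instance Definition _ (m : nat) :=
  Finite.copy (state m) (can_type (@state_codeK m)).

Lemma sum_state {R : nmodType} {m : nat} (F : state m -> R) :
  \sum_s F s = \sum_k F (S1 k) + (\sum_k F (S2 k) + (\sum_k F (S3 k) +
    (\sum_k F (S4 k) + (\sum_k F (S5 k) + \sum_k F (E k))))).
Proof.
rewrite (reindex state_decode) ?big_sumType//=.
by exists state_code => x _; [exact: state_decodeK | exact: state_codeK].
Qed.

(** Each entry of a row of the transition matrix is such a conditional, so a row
has at most one nonzero term in each block of [sum_state]. *)
Lemma sum_if_eq {R : pzSemiRingType} {T : finType} (a : T) (c x : R) :
  \sum_k (if k == a then c else 0) * x = c * x.
Proof.
under eq_bigr do rewrite (fun_if ( *%R^~ x)) /= mul0r.
by rewrite -big_mkcond/= big_pred1_eq.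
Qed.

Definition by_type {R : realType} (h1 h2 h3 h4 h5 : R) {m : nat}
    (s : state m) : R :=
  match s with
  | S1 _ => h1 | S2 _ => h2 | S3 _ => h3 | S4 _ => h4 | S5 _ => h5 | E _ => 0
  end.

(** Lumpability: functions of the type alone are preserved by the transition
matrix, which acts on them by a matrix independent of [m]. *)
Lemma transition_by_type {R : realType} (p q h1 h2 h3 h4 h5 : R) {m : nat}
    (s : state m) :
  \sum_t transition p q s t * by_type h1 h2 h3 h4 h5 t =
  by_type
    (p ^+ 2 * h1 + (1 - p) ^+ 2 * h2 + p * (1 - p) * h5)
    (q ^+ 2 * h1 + (1 - q) ^+ 2 * h2 + q * (1 - q) * h5)
    ((1 - q) ^+ 2 * h3 + (1 - q) * q * h4)
    (q * p * h1 + (1 - q) * (1 - p) * h2 + q * (1 - p) * h5)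
    ((1 - p) * (1 - q) * h3 + (1 - p) * q * h4) s.
Proof.
have z (x : R) : \sum_(k : 'Z_m) (0 : R) * x = 0.
  by rewrite big1// => k _; rewrite mul0r.
by case: s => k; rewrite sum_state /= !sum_if_eq !z ?mulr0; ring.
Qed.

(** The value of [h1], the expected length of a round. *)
Definition round_length {R : realType} (p q : R) : R :=
  (3 - p - q) * (p ^+ 2 - p * q - 2 * p + 2 * q + 1)
  / (q * (3 - p) * (1 - p) * (1 + p - q)).

(** The five first-step equations have an explicit nonnegative solution. Given
[h5], the equations of types 1 and 2 form a linear system in [h1] and [h2] with
determinant
[(1 - p ^+ 2) * (1 - (1 - q) ^+ 2) - (1 - p) ^+ 2 * q ^+ 2 = D];
those of types 4 and 3 then express [h4] and [h3], and that of type 5 determines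
[h5]. In this order each value is visibly nonnegative. *)
Lemma round_potential {R : realType} (p q : R) :
  0 <= p -> p < 1 -> 0 < q -> q <= 1 -> 0 < 1 + p - q ->
  exists h2 h3 h4 h5 : R, let h1 := round_length p q in
  [/\ [/\ 0 <= h1, 0 <= h2, 0 <= h3, 0 <= h4 & 0 <= h5],
   h1 = 1 + (p ^+ 2 * h1 + (1 - p) ^+ 2 * h2 + p * (1 - p) * h5),
   h2 = 1 + (q ^+ 2 * h1 + (1 - q) ^+ 2 * h2 + q * (1 - q) * h5),
   h4 = 1 + (q * p * h1 + (1 - q) * (1 - p) * h2 + q * (1 - p) * h5) &
   h3 = 1 + ((1 - q) ^+ 2 * h3 + (1 - q) * q * h4) /\
   h5 = 1 + ((1 - p) * (1 - q) * h3 + (1 - p) * q * h4)].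
Proof.
move=> p0 p1 q0 q1 pq.
have p1' : 0 < 1 - p by lra.
have q1' : 0 <= 1 - q by lra.
have q2 : 0 < 2 - q by lra.
have p3 : 0 < 3 - p by lra.
pose h5 := ((1 - p) ^+ 2 + 2 * (1 - p) + q * (4 - q)) / (q * (3 - p) * (1 + p - q)).
pose D := 2 * q * (1 - p) * (1 + p - q).
pose h2 := ((1 - p ^+ 2) * (1 + q * (1 - q) * h5)
  + q ^+ 2 * (1 + p * (1 - p) * h5)) / D.
pose h1 := round_length p q.
pose h4 := 1 + (q * p * h1 + (1 - q) * (1 - p) * h2 + q * (1 - p) * h5).
pose h3 := (1 + q * (1 - q) * h4) / (q * (2 - q)).
have den0 : 0 < q * (3 - p) * (1 + p - q) by rewrite !mulr_gt0.
have h50 : 0 <= h5 by apply: divr_ge0; [nra | exact: ltW].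
have D0 : 0 < D by rewrite !mulr_gt0.
have h10 : 0 <= h1.
  (* the second factor of the numerator, as a sum of nonnegative terms *)
  have -> : h1 = (3 - p - q) * ((1 - p) ^+ 2 + q * (2 - p))
      / (q * (3 - p) * (1 - p) * (1 + p - q)).
    by rewrite /h1 /round_length; congr (_ / _); ring.
  apply: divr_ge0; first by apply: mulr_ge0; nra.
  by rewrite !mulr_ge0 ?ltW.
have pp : 0 <= p * (1 - p) * h5 by do 2 apply: mulr_ge0 => //; exact: ltW.
have qq : 0 <= q * (1 - q) * h5 by do 2 apply: mulr_ge0 => //; exact: ltW.
have h20 : 0 <= h2.
  apply: divr_ge0; last exact: ltW.
  apply: addr_ge0; apply: mulr_ge0; rewrite ?sqr_ge0//; [nra | lra | lra].
have h40 : 0 <= h4.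
  apply: addr_ge0 => //; apply: addr_ge0; last first.
    by do 2 apply: mulr_ge0 => //; exact: ltW.
  by apply: addr_ge0; do 2 apply: mulr_ge0 => //; exact: ltW.
have h30 : 0 <= h3.
  apply: divr_ge0; last by rewrite mulr_ge0 ?ltW.
  by apply: addr_ge0 => //; do 2 apply: mulr_ge0 => //; exact: ltW.
have nz : [/\ q != 0, 2 - q != 0, 1 - p != 0, 3 - p != 0 & 1 + p - q != 0].
  by split; rewrite lt0r_neq0.
case: nz => *.
exists h2, h3, h4, h5; split=> //; [| | split].
- by rewrite /h2 /h1 /round_length /D /h5; field; do ?[apply/andP; split].
- by rewrite /h2 /h1 /round_length /D /h5; field; do ?[apply/andP; split].
- by rewrite /h3; field; do ?[apply/andP; split].
- by rewrite /h3 /h4 /h2 /h1 /round_length /D /h5; field; do ?[apply/andP; split].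
Qed.

Lemma round_steps_ge0 {R : realType} {Omega : Type} {m : nat}
    (X : nat -> Omega -> state m) (w : Omega) : (0 <= round_steps R X w)%E.
Proof. by apply: le_ereal_inf_tmp => _ [t _ <-]; rewrite lee_fin. Qed.

(** The potential depends on the type of the state only, so the starting
position and the number of players disappear from the answer. *)
Lemma expected_round_steps {R : realType} {p q : R} {m : nat}
    {d : measure_display} {Omega : measurableType d} {P : probability Omega R}
    {x0 : 'Z_m} {X : nat -> Omega -> state m} :
  0 <= p -> p < 1 -> 0 < q -> q <= 1 -> 0 < 1 + p - q ->
  markov_chain P (transition p q (m := m)) (S1 x0) X ->
  (\int[P]_w round_steps R X w = (round_length p q)%:E)%E.
Proof.
move=> p0 p1 q0 q1 pq mcX.
have [h2 [h3 [h4 [h5 [[? ? ? ? ?] e1 e2 e4 [e3 e5]]]]]] :=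
  round_potential p q p0 p1 q0 q1 pq.
apply: (expected_hitting_time (by_type (round_length p q) h2 h3 h4 h5) mcX).
- by case.
- by case.
- by move=> s; rewrite transition_by_type; case: s.
Qed.

(** * The whole game *)

Theorem corollary5p2 (R : realType) (n : nat) (p q : R)
    (d : measure_display) (Omega : measurableType d) (P : probability Omega R)
    (X : forall m : nat, nat -> Omega -> state m) :
  (2 <= n)%N ->
  0 <= p -> p < 1 -> 0 < q -> q <= 1 -> (p, q) <> (0, 1) ->
  knockout_game P p q n X ->
  (\int[P]_w game_steps R n X w)%E =
  (- (n%:R - 1) * (p + q - 3) * (p ^+ 2 - p * q - 2 * p + 2 * q + 1)
   / (q * (p - 3) * (p - 1) * (p - q + 1)))%:E.
Proof.
move=> n2 p0 p1 q0 q1 npq [mcX _].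
(* [p >= 0] and [q <= 1] leave only [(p, q) = (0, 1)] for equality. *)
have pq : 0 < 1 + p - q.
  rewrite lt_neqAle; apply/andP; split; last by lra.
  by apply/eqP => e; apply: npq; congr (_, _); lra.
(* [X m] is only controlled for [2 <= m <= n]; setting the other summands to 0
   makes all of them measurable. *)
pose T m w := if (2 <= m <= n)%N then round_steps R (X m) w else 0%E.
have -> : (\int[P]_w game_steps R n X w =
    \int[P]_w \sum_(2 <= m < n.+1) T m w)%E.
  apply: eq_integral => w _; apply: eq_big_nat => m mn.
  by rewrite /T -[(m <= n)%N]ltnS mn.
rewrite ge0_integral_sum//; last first.
- by move=> m w _; rewrite /T; case: ifP => // _; exact: round_steps_ge0.
- move=> m; rewrite /T; case: (boolP (2 <= m <= n)%N) => // mn.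
  by have [mX _ _] := mcX m mn; exact: measurable_hitting_time.
rewrite (eq_big_nat _ _ (F2 := fun=> (round_length p q)%:E)); last first.
  move=> m mn; rewrite /T -[(m <= n)%N]ltnS mn.
  by apply: expected_round_steps => //; exact: mcX.
rewrite sumEFin sumr_const_nat subSS; congr EFin; rewrite -[LHS]mulr_natl.
rewrite subn1 /round_length.
have -> : (n.-1%:R : R) = n%:R - 1.
  by rewrite -[n in RHS](ltn_predK n2) -[X in X - 1]natr1 addrK.
by field; do ?[apply/andP; split]; apply/eqP => e; lra.
Qed.
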